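(* Let $\mathcal{X}$ be a Polish space, $c_{\mathcal{X}}:\mathcal{X}\times\mathcal{X}\to[0,\infty]$ a measurable function, and suppose there are $\mu\in\mathscr{P}(\mathcal{X})$ and a constant $C_0>0$ such that for every $\nu\in\mathscr{P}(\mathcal{X})$, $$\Big(\inf_{\pi\in\Pi(\nu,\mu)}\iint_{\mathcal{X}\times\mathcal{X}}c_{\mathcal{X}}^2(x_1,x_2)\,d\pi(x_1,x_2)\Big)^{1/2}\le\sqrt{C_0H(\nu\,|\,\mu)}.$$ Let $\mathcal{Y}$ be a metric space, $c_{\mathcal{Y}}:\mathcal{Y}\times\mathcal{Y}\to[0,\infty]$ a measurable function and assume that there exist a measurable map $\Psi:\mathcal{X}\to\mathcal{Y}$ and $r\ge1$ such that for all $x_1,x_2\in\mathcal{X}_0\subset\mathcal{X}$, with $\mu(\mathcal{X}_0)=1$, $$c_{\mathcal{Y}}\big(\Psi(x_1),\Psi(x_2)\big)\le L(x_1)\Big[c_{\mathcal{X}}(x_1,x_2)\vee c_{\mathcal{X}}(x_1,x_2)^{\frac1r}\Big],$$ where $L\in L^{p^*}(\mathcal{X},\mu)$ for $p^*=2\vee\frac{r}{r-1}$. Then $\tilde\mu=\mu\circ\Psi^{-1}\in\mathscr{T}_\alpha(c_{\mathcal{Y}})$ where, for some constant $C>0$, $\alpha(t)=C(t^2\wedge t^{2r})$.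
   Context: $\mathscr{P}(\mathcal{X})$ denotes Borel probability measures on a metric space $\mathcal{X}$; $\Pi(\mu,\nu)$ the set of couplings of $\mu$ and $\nu$; $W_c(\mu,\nu)=\inf_{\pi\in\Pi(\mu,\nu)}\iint c\,d\pi$; $H(\nu\,|\,\mu)=\int\log(d\nu/d\mu)\,d\nu$ if $\nu\ll\mu$ and $+\infty$ otherwise. For a measurable cost $c$ (with $c(x,x)=0$ for all $x$, as part of the definition) and $\alpha:[0,\infty]\to[0,\infty]$ lower semicontinuous with $\alpha(0)=0$, $\mu\in\mathscr{T}_\alpha(c)$ means $\alpha(W_c(\mu,\nu))\le H(\nu\,|\,\mu)$ for all probability measures $\nu\ll\mu$. $\wedge,\vee$ denote min and max; $\frac{r}{r-1}=\infty$ when $r=1$.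
   Formalization: In the hypothesis the infimum is over Π(μ,ν) (x₁~μ, x₂~ν), not Π(ν,μ): for non-symmetric c_X the printed order makes the claim false (Exp(1), c=(x₂−x₁)⁺); for symmetric c_X nothing changes. Measurability on Y×Y is for the product of the Borel σ-algebras. *)

(* Defs.v *)
From HB Require Import structures.
From mathcomp Require Import all_boot all_order all_algebra.
From mathcomp Require Import all_classical all_reals all_analysis.
From mathcomp Require Import measurable_realfun.

Set Implicit Arguments.
Unset Strict Implicit.
Unset Printing Implicit Defensive.

Import Order.TTheory GRing.Theory Num.Theory.
Import numFieldNormedType.Exports.

Local Open Scope classical_set_scope.
Local Open Scope ring_scope.
Local Open Scope ereal_scope.
Local Open Scope charge_scope.

(* Measurable types are required to be pointed; this excludes only the
   empty space, which carries no probability measure. *)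
#[short(type="pmetricType")]
HB.structure Definition PointedMetric (R : numDomainType) :=
  {T of Pointed T & Metric R T}.

#[short(type="completePMetricType")]
HB.structure Definition CompletePointedMetric (R : numDomainType) :=
  {T of Complete T & Pointed T & Metric R T}.

Definition separable (T : topologicalType) : Prop :=
  exists2 D : set T, countable D & dense D.

Notation borel T := (g_sigma_algebraType (@open T)).

Section transport.
Context {d : measure_display} {T : measurableType d} {R : realType}.
Implicit Types (mu nu : probability T R) (c : T * T -> \bar R).
Implicit Types (alpha : \bar R -> \bar R).

(* The first marginal is [mu], the second is [nu]; couplings live on the
   product sigma-algebra. *)
Definition coupling mu nu : set (probability (T * T)%type R) :=
  [set pi : probability (T * T)%type R | forall A : set T, measurable A ->
     pi (A `*` setT) = mu A /\ pi (setT `*` A) = nu A].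

Definition transport_cost c mu nu : \bar R :=
  ereal_inf [set \int[pi]_z c z | pi in coupling mu nu].

Definition relative_entropy nu mu : \bar R :=
  if `[< nu `<< mu >]
  then \int[nu]_x lne (('d (charge_of_finite_measure nu) '/d mu) x)
  else +oo.

Definition vanishing_cost c : Prop :=
  [/\ measurable_fun [set: T * T] c, (forall z, 0 <= c z) & forall x, c (x, x) = 0].

(* Only the restriction of [alpha] to [0, +oo] matters, hence the subspace
   topology. *)
Definition rate_function alpha : Prop :=
  [/\ (forall t, 0 <= t -> 0 <= alpha t),
      @lower_semicontinuous (subspace [set t : \bar R | 0 <= t]) R alpha
    & alpha 0 = 0].

Definition transport_ineq alpha c : set (probability T R) :=
  [set mu : probability T R | [/\ vanishing_cost c, rate_function alpha
    & forall nu, nu `<< mu ->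
        alpha (transport_cost c mu nu) <= relative_entropy nu mu]].

End transport.

(* r / (r - 1), with value +oo at r = 1. *)
Definition conj_exponent (R : realType) (r : R) : \bar R :=
  if r == 1%R then +oo else (r / (r - 1))%:E.

(* Main.v *)
(** Lift a measure [nuY << mu o Psi^-1] to [X] by precomposing its density with
    [Psi]; this does not change the entropy. Given a coupling [pi] of [mu] and
    the lift with [\int cX^2 dpi <= a], its image under [Psi x Psi] and
    Cauchy-Schwarz bound the square of the transport cost [w] on [Y] by
    [|L|_2^2 (\int cX^2 dpi + \int (cX^2)^(1/r) dpi)], which Jensen's inequality
    bounds by [|L|_2^2 (a + a^(1/r))]. Hence [min (w^2, w^(2r))] is at most a
    constant times [a], and [a] can be taken arbitrarily close to
    [C0 H(nuY | mu o Psi^-1)]. *)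

Require Import Defs.
From HB Require Import structures.
From mathcomp Require Import all_boot all_order all_algebra.
From mathcomp Require Import all_classical all_reals all_analysis.
From mathcomp Require Import measurable_realfun.
From mathcomp Require Import ring lra.

Set Implicit Arguments.
Unset Strict Implicit.
Unset Printing Implicit Defensive.

Import Order.TTheory GRing.Theory Num.Theory.
Import numFieldNormedType.Exports.

Local Open Scope classical_set_scope.
Local Open Scope ring_scope.
Local Open Scope ereal_scope.

(** * Densities and relative entropy *)

Lemma measurable_lne (R : realType) : measurable_fun [set: \bar R] (@lne R).
Proof.
rewrite (_ : @lne R = fun x => if x == +oo then +oo
    else if 0 < x then (ln (fine x))%:E else -oo).
  apply: measurable_fun_ifT => //; first exact: measurable_fun_eqe.
  apply: measurable_fun_ifT => //; first exact: measurable_fun_lte.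
  by apply/measurable_EFinP; apply: measurableT_comp.
by apply/funext => -[x| |]//=; rewrite lte_fin leNgt; case: ltP.
Qed.

Lemma integral_cst_probability d (T : measurableType d) (R : realType)
    (P : probability T R) (k : \bar R) : \int[P]_x k = k.
Proof.
have PT : (P : {measure set T -> \bar R}) setT = 1 by exact: probability_setT.
by rewrite (integral_cst P measurableT) PT mule1.
Qed.

Lemma ex_probability_density d (T : measurableType d) (R : realType)
    (mu : probability T R) (g : T -> \bar R) :
    measurable_fun setT g -> (forall x, 0 <= g x) -> \int[mu]_x g x = 1 ->
  exists nu : probability T R,
    forall A, measurable A -> nu A = \int[mu]_(x in A) g x.
Proof.
move=> mg g0 g1; pose m A := \int[mu]_(x in A) g x.
have m0 : m set0 = 0 by rewrite /m integral_set0.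
have m_ge0 A : 0 <= m A by exact: integral_ge0.
have m_sigma : semi_sigma_additive m.
  move=> F mF tF mUF; rewrite /m ge0_integral_bigcup//; last first.
    exact: measurable_funTS.
  by apply: is_cvg_ereal_nneg_natsum_cond => n _ _; exact: integral_ge0.
pose m_measure := isMeasure.Build d T R m m0 m_ge0 m_sigma.
pose mM : measure T R := HB.pack m m_measure.
pose m_proba := Measure_isProbability.Build d T R mM g1.
pose nu : probability T R := HB.pack (Measure.sort mM) m_measure m_proba.
by exists nu.
Qed.

(** Two densities of [nu] agree [mu]-almost everywhere, hence [nu]-almost everywhere since [nu] is
    dominated by [mu]. This frees entropy computations from the chosen Radon-Nikodym derivative. *)
Lemma relative_entropy_density d (T : measurableType d) (R : realType)
    (nu mu : probability T R) (g : T -> \bar R) :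
    measurable_fun setT g ->
    (forall A, measurable A -> nu A = \int[mu]_(x in A) g x) ->
  relative_entropy nu mu = \int[nu]_x lne (g x).
Proof.
move=> mg nuE.
have numu : nu `<< mu.
  apply/null_content_dominatesP => A mA muA; rewrite nuE//.
  by apply: null_set_integral => //; exact: measurable_funTS.
rewrite /relative_entropy; case: asboolP => // _.
set f := Radon_Nikodym _ _.
have mf : measurable_fun setT f.
  exact/measurable_int/Radon_Nikodym_integrable.
apply: ae_eq_integral => //.
- by apply: measurableT_comp => //; exact: measurable_lne.
- by apply: measurableT_comp => //; exact: measurable_lne.
have fg : ae_eq mu setT f g.
  apply: integral_ae_eq => //; first exact: Radon_Nikodym_integrable.
  by move=> A _ mA; rewrite -nuE// -Radon_Nikodym_integral.
have := null_dominates_ae_eq measurableT numu fg.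
by apply: filterS => x /[apply] ->.
Qed.

(* Integrating [g - 1 <= g ln g] against [mu]; the inequality is split into
   positive and negative parts so that both sides are nonnegative. *)
Lemma relative_entropy_ge0 d (T : measurableType d) (R : realType)
    (nu mu : probability T R) : 0 <= relative_entropy nu mu.
Proof.
have [numu|nN] := pselect (nu `<< mu); last first.
  by rewrite /relative_entropy; case: asboolP.
pose g := Radon_Nikodym_SigmaFinite.f nu mu.
have g0 x : 0 <= g x by exact: Radon_Nikodym_SigmaFinite.f_ge0.
have gfin x : g x \is a fin_num by exact: Radon_Nikodym_SigmaFinite.f_fin_num.
have mg : measurable_fun setT g.
  exact/measurable_int/Radon_Nikodym_SigmaFinite.f_integrable.
have nuE A : measurable A -> nu A = \int[mu]_(x in A) g x.
  by move=> mA; exact: Radon_Nikodym_SigmaFinite.f_integral.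
have g1 : \int[mu]_x g x = 1 by rewrite -nuE// probability_setT.
have mlg : measurable_fun setT (fun x => lne (g x)).
  by apply: measurableT_comp => //; exact: measurable_lne.
have pointwise x : (fun x => lne (g x))^\- x * g x + g x <=
    (fun x => lne (g x))^\+ x * g x + 1 /\
    (fun x => lne (g x))^\- x * g x <= 1.
  rewrite funenegE funeposE.
  have := g0 x; have := gfin x; case: (g x) => [s||]// _.
  (* At a zero of the density [lne] is [-oo], but the convention [+oo * 0 = 0] makes the products
     vanish. *)
  rewrite lee_fin le_eqVlt => /predU1P[<-|s0].
    by rewrite !mule0 !add0e lee01.
  rewrite lne_EFin// -EFinN -!EFin_max -!EFinM -!EFinD !lee_fin.
  (* This is [ln (1 + x) <= x] at [x = s^-1 - 1]; multiplying by [s] gives [s - 1 <= s ln s]. *)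
  have lns : (1 - s^-1 <= ln s)%R.
    have := @le_ln1Dx R (s^-1 - 1)%R.
    rewrite subrKC lnV ?posrE// ltrBrDr addNr invr_gt0 => /(_ s0).
    by lra.
  have slns : (s - 1 <= ln s * s)%R.
    have := ler_wpM2r (ltW s0) lns.
    by rewrite mulrBl mul1r mulVf ?gt_eqF.
  have [ln0|ln0] := leP 0%R (ln s).
    rewrite max_r ?oppr_le0// mul0r; split; lra.
  rewrite max_l ?oppr_ge0 ?(ltW ln0)//; split; lra.
have mN : measurable_fun setT ((fun x => lne (g x))^\- \* g).
  by apply: emeasurable_funM => //; exact: measurable_funeneg.
have mP : measurable_fun setT ((fun x => lne (g x))^\+ \* g).
  by apply: emeasurable_funM => //; exact: measurable_funepos.
have N0 x : 0 <= (fun x => lne (g x))^\- x * g x by rewrite mule_ge0.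
have P0 x : 0 <= (fun x => lne (g x))^\+ x * g x by rewrite mule_ge0.
rewrite (relative_entropy_density mg nuE) integralE.
rewrite -(Radon_Nikodym_SigmaFinite.change_of_variables numu)//; last first.
  exact: measurable_funepos.
rewrite -(Radon_Nikodym_SigmaFinite.change_of_variables numu)//; last first.
  exact: measurable_funeneg.
(* The negative part has a finite integral, so the difference of the two parts is never [+oo - +oo]
   and its sign can be read off by comparing them. *)
rewrite -/g; have Nle1 : \int[mu]_x ((fun x => lne (g x))^\- x * g x) <= 1.
  apply: (@le_trans _ _ (\int[mu]_x 1)).
    by apply: ge0_le_integral => // x _; exact: (pointwise x).2.
  by rewrite integral_cst_probability.
have Nfin : \int[mu]_x ((fun x => lne (g x))^\- x * g x) \is a fin_num.
  rewrite ge0_fin_numE; last exact: integral_ge0.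
  by rewrite (le_lt_trans Nle1)// ltry.
rewrite sube_ge0; last by rewrite Nfin.
have : \int[mu]_x ((fun x => lne (g x))^\- x * g x + g x) <=
    \int[mu]_x ((fun x => lne (g x))^\+ x * g x + 1).
  apply: ge0_le_integral => //.
  - by move=> x _; rewrite adde_ge0.
  - exact: emeasurable_funD.
  - exact: emeasurable_funD.
  - by move=> x _; exact: (pointwise x).1.
by rewrite !ge0_integralD// g1 integral_cst_probability leeD2rE.
Qed.

(** * Jensen and Cauchy-Schwarz inequalities *)

(** A concave function lies below its tangent, here at [a]. Homogeneity reduces this to the tangent
    at 1, which is Young's inequality for [t^(1/r)] and 1 with exponents [r] and [r/(r-1)]; at
    [r = 1] the second exponent would be infinite, so that case is separate. *)
Lemma powR_inv_le_tangent (R : realType) (r a x : R) :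
    (1 <= r)%R -> (0 < a)%R -> (0 <= x)%R ->
  (x `^ r^-1 <= a `^ r^-1 * (r^-1 / a) * x + a `^ r^-1 * (1 - r^-1))%R.
Proof.
move=> r1 a0 x0; have r0 : (0 < r)%R by rewrite (lt_le_trans ltr01).
have bernoulli t : (0 <= t -> t `^ r^-1 <= r^-1 * t + (1 - r^-1))%R.
  move=> t0; move: r1; rewrite le_eqVlt => /predU1P[<-|r1].
    by rewrite invr1 powRr1// mul1r subrr addr0.
  have q0 : (0 < 1 - r^-1)%R by rewrite subr_gt0 invf_lt1.
  have := @conjugate_powR R (t `^ r^-1)%R 1%R r (1 - r^-1)^-1%R
    (powR_ge0 _ _) ler01 r0.
  rewrite invr_gt0 q0 invrK subrKC => /(_ erefl erefl).
  by rewrite mulr1 powR1 -powRrM mulVf ?gt_eqF// powRr1// mul1r (mulrC t).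
have {1}-> : x = (a * (x / a))%R by rewrite mulrC divfK// gt_eqF.
rewrite powRM ?divr_ge0 ?(ltW a0)//.
have := ler_wpM2l (powR_ge0 a r^-1) (bernoulli _ (divr_ge0 x0 (ltW a0))).
move/le_trans; apply; rewrite le_eqVlt; apply/orP; left; apply/eqP.
by field; rewrite !gt_eqF.
Qed.

Section integral_inequalities.
Context d (T : measurableType d) (R : realType) (P : probability T R).

(** Jensen's inequality, by integrating the tangent at [a]: its slope is positive, so the integral
    of [f] may be replaced by [a], where tangent and power coincide. *)
Lemma integral_poweR_inv_le (f : T -> \bar R) (r a : R) :
    (1 <= r)%R -> (0 < a)%R ->
    measurable_fun setT f -> (forall x, 0 <= f x) -> \int[P]_x f x <= a%:E ->
  \int[P]_x (f x `^ r^-1) <= (a `^ r^-1)%:E.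
Proof.
move=> r1 a0 mf f0 fa; have r0 : (0 < r)%R by rewrite (lt_le_trans ltr01).
set k1 := (a `^ r^-1 * (r^-1 / a))%R.
set k2 := (a `^ r^-1 * (1 - r^-1))%R.
have k10 : (0 < k1)%R by rewrite !mulr_gt0 ?powR_gt0 ?invr_gt0.
have k20 : (0 <= k2)%R by rewrite mulr_ge0 ?powR_ge0// subr_ge0 invf_le1.
have kf0 x : 0 <= k1%:E * f x by rewrite mule_ge0// lee_fin ltW.
have mkf : measurable_fun setT (fun x => k1%:E * f x).
  exact: measurable_funeM.
apply: (@le_trans _ _ (\int[P]_x (k1%:E * f x + k2%:E))).
  apply: ge0_le_integral => //.
  - by move=> x _; exact: poweR_ge0.
  - exact: (measurableT_comp (measurable_poweR _)).
  - exact: emeasurable_funD.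
  move=> x _; have := f0 x; case: (f x) => [s|_|//].
    by rewrite lee_fin => s0; rewrite -EFinM -EFinD lee_fin powR_inv_le_tangent.
  by rewrite gt0_muley// leey.
rewrite ge0_integralD//.
rewrite ge0_integralZl ?lee_fin ?(ltW k10)//.
rewrite integral_cst_probability.
apply: le_trans (leeD2r _ (lee_wpmul2l _ fa)) _; first by rewrite lee_fin ltW.
rewrite -EFinM -EFinD lee_fin /k1 /k2 le_eqVlt; apply/orP; left; apply/eqP.
by field; rewrite !gt_eqF.
Qed.

(** Cauchy-Schwarz with an extended-real factor, by integrating a weighted arithmetic-geometric
    inequality. Positivity of [K] and [B] makes the weight well defined and positive. *)
Lemma integral_mul_le_sqrt (l : T -> R) (m : T -> \bar R) (K B : R) :
    (0 < K)%R -> (0 < B)%R ->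
    measurable_fun setT l -> measurable_fun setT m -> (forall x, 0 <= m x) ->
    \int[P]_x ((l x) ^+ 2)%:E <= K%:E -> \int[P]_x (m x ^+ 2) <= B%:E ->
  \int[P]_x (`|l x|%:E * m x) <= (Num.sqrt (K * B))%:E.
Proof.
move=> K0 B0 ml mm m0 lK mB.
(* The optimal [s] in [|l| m <= (s / 2) l^2 + m^2 / (2 s)]. *)
pose s : R := Num.sqrt (B / K).
have s0 : (0 < s)%R by rewrite sqrtr_gt0 divr_gt0.
have s2_ge0 : (0 <= s / 2)%R by rewrite divr_ge0 ?ltW.
have sV2_ge0 : (0 <= s^-1 / 2)%R by rewrite divr_ge0 ?invr_ge0 ?ltW.
have ml2 : measurable_fun setT (fun x => ((s / 2) * (l x) ^+ 2)%:E).
  apply/measurable_EFinP; apply: measurable_funM => //.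
  exact: measurable_funX.
have mm2 : measurable_fun setT (fun x => m x ^+ 2).
  by rewrite /expe /=; exact: emeasurable_funM.
have m20 x : 0 <= m x ^+ 2 by exact: mule_ge0.
have mkm2 : measurable_fun setT (fun x => (s^-1 / 2)%:E * m x ^+ 2).
  exact: measurable_funeM.
have l20 x : 0 <= ((s / 2) * (l x) ^+ 2)%:E.
  by rewrite lee_fin mulr_ge0 ?sqr_ge0.
have km20 x : 0 <= (s^-1 / 2)%:E * m x ^+ 2.
  by rewrite mule_ge0.
apply: (@le_trans _ _
    (\int[P]_x (((s / 2) * (l x) ^+ 2)%:E + (s^-1 / 2)%:E * m x ^+ 2))).
  apply: ge0_le_integral => //.
  - by move=> x _; rewrite mule_ge0.
  - apply: emeasurable_funM => //; apply/measurable_EFinP.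
    exact: measurableT_comp.
  - exact: emeasurable_funD.
  move=> x _; have := m0 x; case: (m x) => [v|_|//]; last first.
    rewrite (_ : +oo ^+ 2 = +oo)//.
    rewrite [X in _ + X]gt0_muley ?lte_fin ?divr_gt0 ?invr_gt0//.
    by rewrite addey ?leey.
  rewrite lee_fin => v0; rewrite -EFin_expe -!EFinM -EFinD lee_fin.
  rewrite -(real_normK (num_real (l x))); set u := `|l x|%R.
  rewrite -subr_ge0.
  rewrite [X in (0 <= X)%R](_ : _ = (s^-1 / 2 * (s * u - v) ^+ 2)%R); last first.
    by field; rewrite gt_eqF.
  by rewrite mulr_ge0 ?sqr_ge0.
rewrite ge0_integralD//.
under eq_integral do rewrite EFinM.
rewrite !ge0_integralZl//; last 2 first.
  by apply/measurable_EFinP; exact: measurable_funX.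
  by move=> x _; rewrite lee_fin sqr_ge0.
apply: (@le_trans _ _ ((s / 2)%:E * K%:E + (s^-1 / 2)%:E * B%:E)).
  by apply: leeD; exact: lee_wpmul2l.
rewrite -!EFinM -EFinD lee_fin.
(* For this [s] both summands equal [s * K / 2]. *)
have BE : B = (s ^+ 2 * K)%R.
  by rewrite sqr_sqrtr ?divr_ge0 ?ltW// divfK ?gt_eqF.
have -> : Num.sqrt (K * B) = (s * K)%R.
  by rewrite BE mulrCA -expr2 -exprMn sqrtr_sqr ger0_norm ?mulr_ge0 ?ltW.
rewrite BE le_eqVlt; apply/orP; left; apply/eqP.
by field; rewrite gt_eqF.
Qed.

End integral_inequalities.

(** * Costs and entropies under a measurable map *)

(** The image of [pi] under [f] on both coordinates couples the image measures, so it competes in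
    the infimum. *)
Lemma transport_cost_distribution_le d d' (T : measurableType d)
    (T' : measurableType d') (R : realType) (mu nu : probability T R)
    (nu' : probability T' R) (f : {mfun T >-> T'}) (c : T' * T' -> \bar R)
    (pi : probability (T * T)%type R) :
    measurable_fun setT c -> (forall z, 0 <= c z) -> coupling mu nu pi ->
    (forall A, measurable A -> nu' A = nu (f @^-1` A)) ->
  transport_cost c (distribution mu f) nu' <= \int[pi]_z c (f z.1, f z.2).
Proof.
move=> mc c0 pi_coupling nu'E.
pose F (z : T * T) := (f z.1, f z.2).
have mF : measurable_fun setT F.
  by apply: measurable_fun_pair; exact: measurableT_comp.
pose F_mfun := isMeasurableFun.Build _ _ _ _ F mF.
pose mfF : {mfun (T * T)%type >-> (T' * T')%type} := HB.pack F F_mfun.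
apply: ereal_inf_lbound; exists (distribution pi mfF) => /=; last first.
  by rewrite ge0_integral_pushforward.
move=> A mA; have mfA : measurable (f @^-1` A).
  by rewrite -[X in measurable X]setTI; exact: measurable_funP.
have [piA Api] := pi_coupling _ mfA.
by rewrite nu'E// -Api -piA.
Qed.

(** If [g] is the density of [nu'], the lift has density [g \o f]. Its image is [nu'], so both
    entropies are the integral of [lne] of [g], before and after a change of variables. *)
Lemma relative_entropy_lift d d' (T : measurableType d)
    (T' : measurableType d') (R : realType) (mu : probability T R)
    (f : {mfun T >-> T'}) (nu' : probability T' R) :
    nu' `<< distribution mu f ->
  exists nu : probability T R, [/\ nu `<< mu,
    (forall A, measurable A -> nu' A = nu (f @^-1` A)) &
    relative_entropy nu mu = relative_entropy nu' (distribution mu f)].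
Proof.
move=> nu'mu; pose g := Radon_Nikodym_SigmaFinite.f nu' (distribution mu f).
have g0 x : 0 <= g x by exact: Radon_Nikodym_SigmaFinite.f_ge0.
have mg : measurable_fun setT g.
  exact/measurable_int/Radon_Nikodym_SigmaFinite.f_integrable.
have nu'E A : measurable A -> nu' A = \int[distribution mu f]_(x in A) g x.
  by move=> mA; exact: Radon_Nikodym_SigmaFinite.f_integral.
have mgf : measurable_fun setT (g \o f) by exact: measurableT_comp.
have nu'pre A : measurable A -> nu' A = \int[mu]_(x in f @^-1` A) (g \o f) x.
  move=> mA; rewrite nu'E// ge0_integral_pushforward//.
  exact: measurable_funTS.
have gf1 : \int[mu]_x (g \o f) x = 1.
  by rewrite -(preimage_setT f) -nu'pre// probability_setT.
have [nu nuE] := ex_probability_density mgf (fun x => g0 (f x)) gf1.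
have nu'nu A : measurable A -> nu' A = nu (f @^-1` A).
  move=> mA; rewrite nu'pre// nuE//.
  by rewrite -[X in measurable X]setTI; exact: measurable_funP.
exists nu; split => //.
  apply/null_content_dominatesP => A mA muA; rewrite nuE//.
  by apply: null_set_integral => //; exact: measurable_funTS.
rewrite (relative_entropy_density mgf nuE) (relative_entropy_density mg nu'E).
have mlg : measurable_fun setT (fun y => lne (g y)).
  by apply: measurableT_comp => //; exact: measurable_lne.
have transfer (h : T' -> \bar R) : measurable_fun setT h ->
    (forall y, 0 <= h y) -> \int[nu]_x (h (f x)) = \int[nu']_y h y.
  move=> mh h0.
  rewrite (eq_measure_integral (pushforward nu f)); last first.
    by move=> A mA _; exact: nu'nu.
  by rewrite ge0_integral_pushforward.
(* The change of variables is for nonnegative functions, hence the split of the logarithm into its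
   two parts. *)
rewrite integralE [RHS]integralE; congr (_ - _).
  rewrite -transfer//; last exact: measurable_funepos.
  by apply: eq_integral => x _; rewrite !funeposE.
rewrite -transfer//; last exact: measurable_funeneg.
by apply: eq_integral => x _; rewrite !funenegE.
Qed.

(** * The cost estimate and its inversion *)

(** Cauchy-Schwarz splits off [l]; the square of the maximum is at most [c^2 + (c^2)^(1/r)], and
    Jensen's inequality handles the second term. *)
Lemma integral_mul_max_poweR_le d (T : measurableType d) (R : realType)
    (P : probability T R) (l : T -> R) (c : T -> \bar R) (K r a : R) :
    (0 < K)%R -> (1 <= r)%R -> (0 < a)%R ->
    measurable_fun setT l -> measurable_fun setT c -> (forall x, 0 <= c x) ->
    \int[P]_x ((l x) ^+ 2)%:E <= K%:E -> \int[P]_x (c x ^+ 2) <= a%:E ->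
  \int[P]_x (`|l x|%:E * maxe (c x) (c x `^ r^-1)) <=
    (Num.sqrt (K * (a + a `^ r^-1)))%:E.
Proof.
move=> K0 r1 a0 ml mc c0 lK ca.
have mc2 : measurable_fun setT (fun x => c x ^+ 2).
  by rewrite /expe /=; exact: emeasurable_funM.
have c20 x : 0 <= c x ^+ 2 by exact: mule_ge0.
have mcr : measurable_fun setT (fun x => c x `^ r^-1).
  exact: (measurableT_comp (measurable_poweR _)).
have mc2r : measurable_fun setT (fun x => (c x ^+ 2) `^ r^-1).
  exact: (measurableT_comp (measurable_poweR _)).
have mmax : measurable_fun setT (fun x => maxe (c x) (c x `^ r^-1)).
  exact: measurable_maxe.
have max0 x : 0 <= maxe (c x) (c x `^ r^-1) by rewrite le_max c0.
apply: integral_mul_le_sqrt => //; first by rewrite addr_gt0 ?powR_gt0.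
apply: (@le_trans _ _ (\int[P]_x (c x ^+ 2 + (c x ^+ 2) `^ r^-1))).
  apply: ge0_le_integral => //.
  - by move=> x _; exact: mule_ge0.
  - by rewrite /expe /=; exact: emeasurable_funM.
  - exact: emeasurable_funD.
  move=> x _; have [_|_] := leP (c x) (c x `^ r^-1); last first.
    by rewrite leeDl// poweR_ge0.
  by rewrite [_ ^+ 2 in leRHS]/expe /= poweRM// leeDr// mule_ge0.
rewrite ge0_integralD//; last by move=> x _; exact: poweR_ge0.
by rewrite EFinD leeD// integral_poweR_inv_le.
Qed.

(** For [a >= 1] the term [a] dominates and [w^2 <= 2 K a]; for [a < 1] the term [a^(1/r)]
    dominates, and raising [w^2 <= 2 K a^(1/r)] to the power [r] gives the bound on [w^(2r)]. Since
    [1 <= 2 * K], the constant [(2 K)^r] serves both cases. *)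
Lemma min_sqr_powR_le (R : realType) (K r a w : R) :
    (1 <= 2 * K)%R -> (1 <= r)%R -> (0 < a)%R -> (0 <= w)%R ->
    (w <= Num.sqrt (K * (a + a `^ r^-1)))%R ->
  (Num.min (w ^+ 2) (w `^ (2 * r)) <= (2 * K) `^ r * a)%R.
Proof.
move=> K1 r1 a0 w0 wle; have r0 : (0 < r)%R by rewrite (lt_le_trans ltr01).
have K0 : (0 <= K)%R by lra.
have w2 : (w ^+ 2 <= K * (a + a `^ r^-1))%R.
  rewrite -[leRHS]sqr_sqrtr ?lerXn2r ?nnegrE ?sqrtr_ge0//.
  by rewrite mulr_ge0// addr_ge0 ?powR_ge0// ltW.
have [a1|a1] := leP 1%R a.
  have ar : (a `^ r^-1 <= a)%R.
    by rewrite -[leRHS]powRr1 ?(ltW a0)// ler_powR// invf_le1.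
  have Kr : (2 * K <= (2 * K) `^ r)%R.
    by rewrite -[leLHS]powRr1 ?ler_powR// mulr_ge0.
  rewrite ge_min; apply/orP; left; rewrite (le_trans w2)//.
  apply: (@le_trans _ _ (2 * K * a)%R); last by rewrite ler_wpM2r// ltW.
  by rewrite [(2 * K)%R]mulrC -mulrA ler_wpM2l//; lra.
have ar : (a <= a `^ r^-1)%R by rewrite ger1_powR ?a0 ?(ltW a1)// invf_le1.
rewrite ge_min; apply/orP; right; rewrite powRrM powR_mulrn//.
apply: (@le_trans _ _ ((2 * K * a `^ r^-1) `^ r)%R).
  rewrite ge0_ler_powR ?nnegrE ?(ltW r0) ?sqr_ge0 ?mulr_ge0 ?powR_ge0//.
  rewrite (le_trans w2)// [(2 * K)%R]mulrC -mulrA ler_wpM2l//; lra.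
rewrite powRM ?powR_ge0 ?mulr_ge0// -powRrM mulVf ?gt_eqF// powRr1//.
exact: ltW.
Qed.

(** * Marginals of a coupling *)

Lemma integral_coupling_fst d (T : measurableType d) (R : realType)
    (mu nu : probability T R) (pi : probability (T * T)%type R)
    (f : T -> \bar R) :
    coupling mu nu pi -> measurable_fun setT f -> (forall x, 0 <= f x) ->
  \int[pi]_z f z.1 = \int[mu]_x f x.
Proof.
move=> pi_coupling mf f0.
rewrite (eq_measure_integral (pushforward pi fst)); last first.
  move=> A mA _; have := (pi_coupling A mA).1.
  by rewrite setXT => h; exact: esym h.
by rewrite ge0_integral_pushforward.
Qed.

(** Domination makes the complement of [A] null for the second marginal too, so a bound assumed only
    on [A] in both variables holds [pi]-almost everywhere. *)
Lemma ae_coupling d (T : measurableType d) (R : realType)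
    (mu nu : probability T R) (pi : probability (T * T)%type R) (A : set T) :
    coupling mu nu pi -> nu `<< mu -> measurable A -> mu A = 1 ->
  {ae pi, forall z, A z.1 /\ A z.2}.
Proof.
move=> pi_coupling numu mA muA.
have mCA : measurable (~` A) by exact: measurableC.
have muCA : mu (~` A) = 0 by rewrite probability_setC// muA subee.
have nuCA : nu (~` A) = 0.
  by move/null_content_dominatesP : numu; apply.
have [pi1 pi2] := pi_coupling _ mCA.
have ae1 : {ae pi, forall z, A z.1}.
  exists (~` A `*` setT); split.
  - exact: measurableX.
  - by rewrite pi1.
  - by move=> z /= Az; split.
have ae2 : {ae pi, forall z, A z.2}.
  exists (setT `*` ~` A); split.
  - exact: measurableX.
  - by rewrite pi2.
  - by move=> z /= Az; split.
by apply: filterS2 ae1 ae2 => z.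
Qed.

(** * The rate function *)

Lemma lte_poweR_inv (R : realType) (b p : R) (x : \bar R) :
    (0 <= b)%R -> (0 < p)%R -> 0 <= x ->
  (b%:E < x `^ p) = ((b `^ p^-1)%:E < x).
Proof.
move=> b0 p0; case: x => [x|_|//]; last by rewrite poweRyr ?gt_eqF// !ltry.
rewrite lee_fin poweR_EFin !lte_fin => x0.
have pV0 : (0 < p^-1)%R by rewrite invr_gt0.
apply/idP/idP => h.
  have := gt0_ltr_powR pV0 b0 (powR_ge0 x p) h.
  by rewrite -powRrM mulfV ?gt_eqF// powRr1.
have := gt0_ltr_powR p0 (powR_ge0 b _) x0 h.
by rewrite -powRrM mulVf ?gt_eqF// powRr1.
Qed.

Lemma expe2_poweR (R : realType) (x : \bar R) : 0 <= x -> x ^+ 2 = x `^ 2.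
Proof.
case: x => [x|_|//]; last by rewrite poweRyr// pnatr_eq0.
by rewrite lee_fin => x0; rewrite -EFin_expe poweR_EFin powR_mulrn.
Qed.

(** For a level [a >= 0], the points of [[0, +oo]] where the function exceeds [a] form an open ray,
    whose endpoint comes from inverting the two powers. *)
Lemma rate_function_min_poweR (R : realType) (C r : R) :
    (0 < C)%R -> (0 < r)%R ->
  rate_function (fun t : \bar R => C%:E * mine (t ^+ 2) (t `^ (2 * r))).
Proof.
move=> C0 r0; have r20 : (0 < 2 * r)%R by rewrite mulr_gt0.
set alpha := fun t : \bar R => _.
have alpha_ge0 t : 0 <= t -> 0 <= alpha t.
  move=> t0; rewrite mule_ge0 ?lee_fin ?(ltW C0)//.
  by rewrite le_min poweR_ge0 mule_ge0.
split => //; last first.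
  rewrite /alpha poweR0r ?gt_eqF// (_ : 0 ^+ 2 = 0) ?minxx ?mule0//.
  by rewrite /expe /= mule0.
move=> x a; have [x0 ax|x0 ax] := pselect (0 <= x); last first.
  (* Outside [[0, +oo]] the subspace topology is discrete. *)
  exists [set x]; last by move=> y ->.
  case: (nbhs_subspaceP [set t : \bar R | 0 <= t] x) => //.
  by move=> _ y.
have [a0|a0] := ltP a 0%R.
  exists [set t : \bar R | 0 <= t].
    apply/(@nbhs_subspace_ex _ [set t : \bar R | 0 <= t] _ x x0).
    exists setT; first exact: filterT.
    by rewrite setTI setIid.
  by move=> y /alpha_ge0; apply: lt_le_trans; rewrite lte_fin.
pose b := (C^-1 * a)%R.
have b0 : (0 <= b)%R by rewrite mulr_ge0// invr_ge0 ltW.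
(* The minimum of the powers exceeds [b] exactly when both do, hence the larger of the two
   thresholds. *)
pose s := Num.max (b `^ 2^-1)%R (b `^ (2 * r)^-1)%R.
have alphaE y : 0 <= y -> (a%:E < alpha y) = (s%:E < y).
  move=> y0; rewrite /alpha -lte_pdivrMl// -EFinM lt_min expe2_poweR//.
  by rewrite !lte_poweR_inv// EFin_max gt_max.
exists ([set t : \bar R | s%:E < t] `&` [set t : \bar R | 0 <= t]); last first.
  by move=> y [sy y0]; rewrite alphaE.
apply/(@nbhs_subspace_ex _ [set t : \bar R | 0 <= t] _ x x0).
exists [set t | s%:E < t]; last first.
  by rewrite -setIA setIid.
apply: open_nbhs_nbhs; split; first exact: open_ereal_gt_ereal.
by rewrite /= -alphaE.
Qed.

(** * The transport inequality for the image measure *)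

Theorem lemma2p11 (R : realType)
  (X : completePMetricType R) (sepX : separable X)
  (cX : borel X * borel X -> \bar R)
  (mcX : measurable_fun [set: borel X * borel X] cX)
  (cX_ge0 : forall z, 0 <= cX z)
  (mu : probability (borel X) R) (C0 : R) (C0_gt0 : (0 < C0)%R)
  (T2_mu : forall nu : probability (borel X) R,
     sqrte (transport_cost (fun z => cX z ^+ 2) mu nu)
       <= sqrte (C0%:E * relative_entropy nu mu))
  (Y : pmetricType R)
  (cY : borel Y * borel Y -> \bar R)
  (mcY : measurable_fun [set: borel Y * borel Y] cY)
  (cY_ge0 : forall z, 0 <= cY z)
  (cY_diag : forall y, cY (y, y) = 0)
  (Psi : {mfun borel X >-> borel Y})
  (r : R) (r_ge1 : (1 <= r)%R)
  (X0 : set (borel X)) (mX0 : measurable X0) (mu_X0 : mu X0 = 1)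
  (L : borel X -> R)
  (L_Lp : L \in Lfun mu (maxe 2%:E (conj_exponent r)))
  (cY_le : forall x1 x2, X0 x1 -> X0 x2 ->
     cY (Psi x1, Psi x2)
       <= (L x1)%:E * maxe (cX (x1, x2)) (cX (x1, x2) `^ r^-1)) :
  exists2 C : R, (0 < C)%R &
    transport_ineq (fun t => C%:E * mine (t ^+ 2) (t `^ (2 * r))) cY
      (distribution mu Psi).
Proof.
have r_gt0 : (0 < r)%R by rewrite (lt_le_trans ltr01).
have le12 : (1 : \bar R) <= 2%:E by rewrite lee_fin ler1n.
have le1max : 1 <= maxe 2%:E (conj_exponent r) by rewrite le_max le12.
have L2 : L \in Lfun mu 2%:E.
  apply: (Lfun_subset le12 le1max) L_Lp; first exact: fin_num_measure.
  by rewrite le_max lexx.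
have mL : measurable_fun setT L by have := sub_Lfun_mfun L2; rewrite inE.
have iL2 := Lfun2_integrable_sqr L2.
(* Adding 1 keeps [K] positive, with [1 <= 2 * K], even when [L] vanishes almost everywhere. *)
pose K := (fine (\int[mu]_x ((L x) ^+ 2)%:E) + 1)%R.
have LK : \int[mu]_x ((L x) ^+ 2)%:E <= K%:E.
  rewrite EFinD fineK ?leeDl// ?lee_fin//.
  exact: integrable_fin_num iL2.
have K1 : (1 <= K)%R.
  rewrite lerDr fine_ge0// integral_ge0// => x _.
  by rewrite lee_fin sqr_ge0.
move: K LK K1 => K LK K1.
have K2r_gt0 : (0 < (2 * K) `^ r)%R by apply: powR_gt0; lra.
(* The factor [(2 K)^r] comes from [min_sqr_powR_le], the factor [C0] from the choice of [a]
   below. *)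
exists ((2 * K) `^ r * C0)^-1%R; first by rewrite invr_gt0 mulr_gt0.
split; first by split.
  by apply: rate_function_min_poweR; rewrite // invr_gt0 mulr_gt0.
move=> nuY nuY_mu.
have [nu [numu nuYE <-]] := relative_entropy_lift nuY_mu.
have := relative_entropy_ge0 nu mu; have := T2_mu nu.
case: (relative_entropy nu mu) => [h| |]//; last by move=> _ _; rewrite leey.
rewrite lee_fin => + h0; rewrite lee_sqrt; last first.
  by rewrite mule_ge0// lee_fin ltW.
(* The infimum over couplings need not be attained: the slack [e] yields a coupling of cost at most
   [a], and keeps [a] positive when [h = 0]. *)
rewrite -EFinM => Wh; apply/lee_addgt0Pr => e e0.
pose a := (C0 * (h + e))%R.
have a0 : (0 < a)%R by rewrite mulr_gt0// ltr_wpDl.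
have : transport_cost (fun z => cX z ^+ 2) mu nu < a%:E.
  by rewrite (le_lt_trans Wh)// lte_fin ltr_pM2l// ltrDl.
move/ereal_inf_lt => [_ [pi pi_coupling <-] /ltW cXa].
set w := transport_cost cY _ _.
have w0 : 0 <= w.
  by apply: le_ereal_inf_tmp => _ [? _ <-]; exact: integral_ge0.
have mL1 : measurable_fun setT (fun z : borel X * borel X => L z.1).
  exact: measurableT_comp.
have mmax : measurable_fun setT
    (fun z : borel X * borel X => maxe (cX z) (cX z `^ r^-1)).
  apply: measurable_maxe => //.
  exact: (measurableT_comp (measurable_poweR _)).
have max0 z : 0 <= maxe (cX z) (cX z `^ r^-1) by rewrite le_max cX_ge0.
have wle : w <= (Num.sqrt (K * (a + a `^ r^-1)))%:E.
  apply: le_trans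
    (transport_cost_distribution_le mcY cY_ge0 pi_coupling nuYE) _.
  apply: (@le_trans _ _
      (\int[pi]_z (`|L z.1|%:E * maxe (cX z) (cX z `^ r^-1)))).
    apply: ae_ge0_le_integral => //.
    - apply: measurableT_comp => //.
      by apply: measurable_fun_pair; exact: measurableT_comp.
    - by move=> z _; rewrite mule_ge0.
    - apply: emeasurable_funM => //; apply/measurable_EFinP.
      exact: measurableT_comp.
    have := ae_coupling pi_coupling numu mX0 mu_X0.
    apply: filterS => -[x1 x2] [/= X01 X02] _ /=.
    (* [L] may be negative; its absolute value keeps the integrand nonnegative everywhere. *)
    apply: le_trans (cY_le _ _ X01 X02) _; apply: lee_wpmul2r => //.
    by rewrite lee_fin ler_norm.
  apply: integral_mul_max_poweR_le => //; first by rewrite (lt_le_trans ltr01).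
  rewrite (integral_coupling_fst (f := fun x => ((L x) ^+ 2)%:E) pi_coupling)//.
    by apply/measurable_EFinP; exact: measurable_funX.
  by move=> x; rewrite lee_fin sqr_ge0.
move: w w0 wle => [w| |]//; rewrite !lee_fin => w0 wle.
rewrite poweR_EFin -EFin_expe -EFin_min -EFinM lee_fin.
rewrite ler_pdivrMl ?mulr_gt0// -mulrA; apply: min_sqr_powR_le => //.
by lra.
Qed.
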